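(* Let $k$ be a positive integer and let $f\in\mathbb R(x_1,\dots,x_n)$ be a rational function whose indeterminacy locus $\mathrm{pol}(f)$ has codimension at least two in $\mathbb R^n$. Then $f$ extends to a function in $\mathcal R^k(\mathbb R^n)$ if and only if, for all $i_1,\dots,i_k\in\{1,\dots,n\}$, the $k$-th partial derivative $\partial^k_{x_{i_1}\cdots x_{i_k}}f$, seen as a function on $\mathrm{dom}(f)$, extends continuously to $\mathbb R^n$.
   Context: For a rational function $f$ on $\mathbb R^n$, $\mathrm{dom}(f)$ is the largest Zariski open set on which $f$ is regular (of the form $p/q$ with polynomials $p,q$, $q$ nonvanishing there) and $\mathrm{pol}(f)=\mathbb R^n\setminus\mathrm{dom}(f)$. For $k\in\mathbb N\cup\{\infty\}$, $\mathcal R^k(\mathbb R^n)$ denotes the ring of functions $f:\mathbb R^n\to\mathbb R$ of class $C^k$ that coincide with a rational function on a nonempty Zariski open subset ($k$-regulous functions). *)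

(* Defs.v *)
From mathcomp Require Import ssreflect ssrbool eqtype ssrnat seq fintype.
From Stdlib Require Import Reals.
Open Scope R_scope.

Set Implicit Arguments.

Definition pt (n : nat) := 'I_n -> R.

Definition shift n (x : pt n) (i : 'I_n) (t : R) : pt n :=
  fun j => if j == i then x j + t else x j.

(** Polynomial functions on R^n (over the infinite field R these are
    identified with polynomials in R[x_1,...,x_n]). *)
Inductive is_poly (n : nat) : (pt n -> R) -> Prop :=
| poly_const (c : R) : is_poly (fun _ => c)
| poly_coord (i : 'I_n) : is_poly (fun x => x i)
| poly_add p q : is_poly p -> is_poly q -> is_poly (fun x => p x + q x)
| poly_mul p q : is_poly p -> is_poly q -> is_poly (fun x => p x * q x).

(** A rational function f = p/q (q a nonzero polynomial). The domain dom(f)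
    is the set of points where f has a representative p'/q' with q'(x) <> 0,
    i.e. the largest (Zariski open) set on which f is regular. *)
Definition rat_dom n (p q : pt n -> R) (x : pt n) : Prop :=
  exists p' q', is_poly p' /\ is_poly q' /\ q' x <> 0 /\
    (forall y, p' y * q y = p y * q' y).

Definition rat_pol n (p q : pt n -> R) (x : pt n) : Prop := ~ rat_dom p q x.

Definition agrees_on n (U : pt n -> Prop) (g p q : pt n -> R) : Prop :=
  forall x p' q', U x -> is_poly p' -> is_poly q' -> q' x <> 0 ->
    (forall y, p' y * q y = p y * q' y) -> g x = p' x / q' x.

Definition zariski_closed n (V : pt n -> Prop) : Prop :=
  exists S : (pt n -> R) -> Prop, (forall s, S s -> is_poly s) /\
    forall x, V x <-> (forall s, S s -> s x = 0).
Definition zariski_open n (U : pt n -> Prop) : Prop :=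
  zariski_closed (fun x => ~ U x).

(** Ideals of the polynomial ring, prime ideals, the vanishing ideal I(V),
    and Krull dimension of R[V] = R[x]/I(V) (dimension of a real algebraic set). *)
Definition prime_ideal n (P : (pt n -> R) -> Prop) : Prop :=
  (forall a, P a -> is_poly a) /\
  P (fun _ => 0) /\
  (forall a b, P a -> P b -> P (fun x => a x + b x)) /\
  (forall a c, P a -> is_poly c -> P (fun x => c x * a x)) /\
  ~ P (fun _ => 1) /\
  (forall a b, is_poly a -> is_poly b -> P (fun x => a x * b x) -> P a \/ P b).

Definition vanishing_ideal n (V : pt n -> Prop) (a : pt n -> R) : Prop :=
  is_poly a /\ forall x, V x -> a x = 0.

Definition dim_ge n (V : pt n -> Prop) (m : nat) : Prop :=
  exists c : nat -> (pt n -> R) -> Prop,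
    (forall j, (j <= m)%nat -> prime_ideal (c j) /\
        (forall a, vanishing_ideal V a -> c j a)) /\
    (forall j, (j < m)%nat ->
        (forall a, c j a -> c j.+1 a) /\ (exists a, c j.+1 a /\ ~ c j a)).

(** codim V >= 2 in R^n, i.e. dim V <= n - 2 (with dim(empty) = -1). *)
Definition codim_ge2 n (V : pt n -> Prop) : Prop := ~ dim_ge V (n - 1).

(** Euclidean topology (via the equivalent sup-norm). *)
Definition continuous_on_Rn n (g : pt n -> R) : Prop :=
  forall x eps, 0 < eps -> exists delta, 0 < delta /\
    forall y, (forall i, Rabs (y i - x i) < delta) -> Rabs (g y - g x) < eps.

Definition partial_at n (g : pt n -> R) (i : 'I_n) (x : pt n) (l : R) : Prop :=
  derivable_pt_lim (fun t => g (shift x i t)) 0 l.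

Fixpoint Ck n (k : nat) (g : pt n -> R) : Prop :=
  match k with
  | O => continuous_on_Rn g
  | S k' => continuous_on_Rn g /\
      forall i, exists G, (forall x, partial_at g i x (G x)) /\ Ck k' G
  end.

Definition regulous n (k : nat) (g : pt n -> R) : Prop :=
  Ck k g /\ exists p q U, is_poly p /\ is_poly q /\ zariski_open U /\
    (exists x, U x) /\ (forall x, U x -> q x <> 0) /\
    (forall x, U x -> g x = p x / q x).

Fixpoint partials_on n (U : pt n -> Prop) (F : pt n -> R) (ids : seq 'I_n)
    (D : pt n -> R) : Prop :=
  match ids with
  | [::] => forall x, U x -> D x = F x
  | i :: ids' => exists G, (forall x, U x -> partial_at F i x (G x)) /\
                  partials_on U G ids' D
  end.

(* Main.v *)
Require Import Defs.
From mathcomp Require Import ssreflect ssrfun ssrbool eqtype ssrnat seq fintype.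
From Stdlib Require Import Reals Lra Lia Classical IndefiniteDescription FunctionalExtensionality.
Open Scope R_scope.

(** By induction on [k] it suffices to treat first derivatives: if [F = P/Q] on
    the dense open set [q <> 0] and each [d_j F] extends to a continuous [h_j],
    then [F] extends to a continuous [g] with [d_j g = h_j].  Eliminating [x_j],
    write [F = p'/q'] with [u p' + v q' = r], where [r <> 0] does not involve
    [x_j].  On a line parallel to the [j]-th axis with [r <> 0], [p'] and [q']
    have no common zero, while [F] is locally bounded because [h_j] is; hence
    [q'] has no zero there, [F] continues to a [C^1] function on the whole line,
    and the mean value theorem holds across the poles of [P/Q].  Any two points
    of [q <> 0] are joined, after a small generic translation, by a path whose
    edges lie on such lines, so [F] is locally uniformly continuous and extends;
    the mean value theorem on nearby generic lines then gives [d_j g = h_j]. *)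

(** * Functions of one real variable *)

Lemma continuity_pt_epsP (f : R -> R) (s : R) :
  continuity_pt f s <->
  (forall eps, 0 < eps -> exists delta, 0 < delta /\
     forall t, Rabs (t - s) < delta -> Rabs (f t - f s) < eps).
Proof.
split.
- move=> cf eps eps0; have [d [d0 Hd]] := cf eps eps0.
  exists d; split => // t Ht.
  case: (Req_dec t s) => [->|nts]; first by rewrite Rminus_diag Rabs_R0.
  by apply: Hd; split => //; split => // e; apply: nts.
- move=> H eps eps0; have [d [d0 Hd]] := H eps eps0.
  by exists d; split => // t [_ Ht]; apply: Hd.
Qed.

(** One-sided limits are enough throughout: on a line where a polynomial is not identically zero,
    its nonvanishing set contains a punctured right neighbourhood of every point. *)
Lemma right_limit_le0 (f : R -> R) (s : R) :
  continuity_pt f s ->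
  (exists e, 0 < e /\ forall t, s < t < s + e -> f t <= 0) -> f s <= 0.
Proof.
move=> /continuity_pt_epsP cf [e [e0 He]].
case: (Rle_lt_dec (f s) 0) => // fs0.
have [d [d0 Hd]] := cf _ fs0.
have m0 : 0 < Rmin e d by apply: Rmin_pos.
have me := Rmin_l e d; have md := Rmin_r e d.
have H1 := He (s + Rmin e d / 2) ltac:(lra).
have H2 : Rabs (f (s + Rmin e d / 2) - f s) < f s.
  apply: Hd; replace (s + Rmin e d / 2 - s) with (Rmin e d / 2) by ring.
  rewrite Rabs_pos_eq; lra.
move: (Rabs_def2 _ _ H2); lra.
Qed.

Lemma right_limit_eq (f g : R -> R) (s : R) :
  continuity_pt f s -> continuity_pt g s ->
  (exists e, 0 < e /\ forall t, s < t < s + e -> f t = g t) -> f s = g s.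
Proof.
move=> cf cg [e [e0 He]].
have H1 : (f - g)%F s <= 0.
  apply: right_limit_le0; first exact: continuity_pt_minus.
  exists e; split => // t /He; rewrite /minus_fct; lra.
have H2 : (g - f)%F s <= 0.
  apply: right_limit_le0; first exact: continuity_pt_minus.
  exists e; split => // t /He; rewrite /minus_fct; lra.
move: H1 H2; rewrite /minus_fct; lra.
Qed.

(* If [P1] and [Q1] have no common zero, the local boundedness of [F] (whose
   derivative [h] is locally bounded) forbids [Q1] to vanish: near a zero [s]
   of [Q1] the relation [P1 = F * Q1] would force [P1 s = 0]. *)
Lemma denominator_neq0 (Z : R -> Prop) (F h P1 Q1 : R -> R) :
  (forall s, exists e, 0 < e /\ forall t, s < t < s + e -> Z t) ->
  (forall t, Z t -> derivable_pt_lim F t (h t)) ->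
  continuity h -> continuity P1 -> continuity Q1 ->
  (forall t, Z t -> P1 t = F t * Q1 t) ->
  (forall t, ~ (P1 t = 0 /\ Q1 t = 0)) ->
  forall s, Q1 s <> 0.
Proof.
move=> Zr dF ch cP cQ PFQ cop s Qs; apply: (cop s); split => //.
have [e [e0 He]] := Zr s.
have [d [d0 Hd]] := proj1 (continuity_pt_epsP h s) (ch s) 1 Rlt_0_1.
(* Halving makes [s + m] itself lie in [Z] and in the range where [h] is bounded, so it can serve as
   base point for the mean value theorem. *)
set m := Rmin e d / 2.
have m0 : 0 < m by rewrite /m; have := Rmin_pos _ _ e0 d0; lra.
have me : m < e by rewrite /m; have := Rmin_l e d; lra.
have md : m < d by rewrite /m; have := Rmin_r e d; lra.
set M := Rabs (h s) + 1.
have hM t : s < t < s + d -> Rabs (h t) <= M.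
  move=> Ht; have H1 : Rabs (h t - h s) < 1 by apply: Hd; rewrite Rabs_pos_eq; lra.
  have := Rabs_triang (h t - h s) (h s).
  replace (h t - h s + h s) with (h t) by ring; rewrite /M; lra.
have M0 : 0 <= M by rewrite /M; have := Rabs_pos (h s); lra.
set C := Rabs (F (s + m)) + M * m.
have FC t : s < t < s + m -> Rabs (F t) <= C.
  move=> Ht.
  have [c [Hc1 Hc2]] := MVT_cor2 F h t (s + m) ltac:(lra)
     (fun c Hc => dF c (He c ltac:(lra))).
  have Hc := hM c ltac:(lra).
  replace (F t) with (F (s + m) + - (h c * (s + m - t))) by lra.
  apply: (Rle_trans _ _ _ (Rabs_triang _ _)).
  rewrite Rabs_Ropp Rabs_mult /C (Rabs_pos_eq (s + m - t)); last lra.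
  apply: Rplus_le_compat_l; apply: Rmult_le_compat => //; try lra; exact: Rabs_pos.
have H : Rabs (P1 s) - C * Rabs (Q1 s) <= 0.
  apply: (right_limit_le0 (fun t => Rabs (P1 t) - C * Rabs (Q1 t))).
    apply: continuity_pt_minus.
      exact: (continuity_pt_comp P1 Rabs _ (cP s) (Rcontinuity_abs _)).
    apply: continuity_pt_scal.
    exact: (continuity_pt_comp Q1 Rabs _ (cQ s) (Rcontinuity_abs _)).
  exists m; split => // t Ht.
  rewrite PFQ; last by apply: He; lra.
  rewrite Rabs_mult.
  have := Rmult_le_compat_r _ _ _ (Rabs_pos (Q1 t)) (FC t Ht); lra.
move: H; rewrite Qs Rabs_R0 => H.
by apply: NNPP => /Rabs_pos_lt; lra.
Qed.

(** The quotient [P1 / Q1] has no pole, so it is a C^1 function on the whole line that equals [F] on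
    [Z]. Its derivative equals [h] on [Z], hence everywhere by continuity, and the ordinary mean
    value theorem for [P1 / Q1] ignores the gaps of [Z]. *)
Lemma mean_value_through_zeros (Z : R -> Prop) (F h P1 Q1 dP dQ : R -> R) :
  (forall s, exists e, 0 < e /\ forall t, s < t < s + e -> Z t) ->
  (forall t, Z t -> exists e, 0 < e /\ forall s, Rabs (s - t) < e -> Z s) ->
  (forall t, Z t -> derivable_pt_lim F t (h t)) ->
  continuity h ->
  (forall t, derivable_pt_lim P1 t (dP t)) ->
  (forall t, derivable_pt_lim Q1 t (dQ t)) ->
  continuity dP -> continuity dQ ->
  (forall t, Z t -> P1 t = F t * Q1 t) ->
  (forall t, ~ (P1 t = 0 /\ Q1 t = 0)) ->
  forall s t, Z s -> Z t -> s < t ->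
  exists c, s <= c <= t /\ F t - F s = (t - s) * h c.
Proof.
move=> Zr Zo dF ch dP1 dQ1 cdP cdQ PFQ cop s t Zs Zt st.
have cP : continuity P1.
  by move=> u; apply: derivable_continuous_pt; exists (dP u); apply: dP1.
have cQ : continuity Q1.
  by move=> u; apply: derivable_continuous_pt; exists (dQ u); apply: dQ1.
have Q0 := denominator_neq0 Z F h P1 Q1 Zr dF ch cP cQ PFQ cop.
have phiF u : Z u -> (P1 / Q1)%F u = F u.
  by move=> Zu; rewrite /div_fct PFQ //; field; apply: Q0.
pose dphi := ((dP * Q1 - dQ * P1) / (Q1 * Q1))%F.
have dphiE u : derivable_pt_lim (P1 / Q1)%F u (dphi u).
  exact: derivable_pt_lim_div.
have Q20 u : (Q1 * Q1)%F u <> 0 by rewrite /mult_fct; apply: Rmult_integral_contrapositive.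
have cdphi : continuity dphi.
  apply: continuity_div => //; last exact: continuity_mult.
  by apply: continuity_minus; apply: continuity_mult.
have dphih u : dphi u = h u.
  apply: right_limit_eq => //.
  (* Since [Z] is open, [P1 / Q1] and [F] agree near [w], so they have the same derivative there. *)
  have [e [e0 He]] := Zr u; exists e; split => // w Hw.
  have Zw := He w Hw; have [e' [e'0 He']] := Zo w Zw.
  apply: (uniqueness_limite F w); last exact: dF.
  apply: (derivable_pt_lim_locally_ext (P1 / Q1)%F F w (w - e') (w + e')) => //.
    lra.
  by move=> z Hz; apply: phiF; apply: He'; apply: Rabs_def1; lra.
have [c [Hc1 Hc2]] := MVT_cor2 (P1 / Q1)%F dphi s t st (fun c _ => dphiE c).
exists c; split; first lra.
by rewrite -(phiF t) // -(phiF s) // Hc1 dphih Rmult_comm.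
Qed.

(** * Univariate polynomials and their isolated zeros *)

Fixpoint horner (l : seq R) (t : R) : R :=
  if l is a :: l' then a + t * horner l' t else 0.

Definition univ_poly (f : R -> R) : Prop := exists l, forall t, f t = horner l t.

Lemma univ_poly_add (f g : R -> R) :
  univ_poly f -> univ_poly g -> univ_poly (fun t => f t + g t).
Proof.
move=> [l1 H1] [l2 H2].
have [l Hl] : univ_poly (fun t => horner l1 t + horner l2 t).
  elim: l1 l2 {H1 H2} => [|a l1 IH] l2.
    by exists l2 => t /=; ring.
  case: l2 => [|b l2]; first by exists (a :: l1) => t /=; ring.
  have [l Hl] := IH l2.
  by exists (a + b :: l) => t /=; rewrite -Hl; ring.
by exists l => t; rewrite H1 H2 Hl.
Qed.

Lemma univ_poly_mul (f g : R -> R) :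
  univ_poly f -> univ_poly g -> univ_poly (fun t => f t * g t).
Proof.
have scal a l2 : univ_poly (fun t => a * horner l2 t).
  elim: l2 => [|b l2 [l Hl]]; first by exists [::] => t /=; ring.
  by exists (a * b :: l) => t /=; rewrite -Hl; ring.
move=> [l1 H1] [l2 H2].
have [l Hl] : univ_poly (fun t => horner l1 t * horner l2 t).
  elim: l1 {H1} => [|a l1 [l Hl]]; first by exists [::] => t /=; ring.
  have [l3 H3] : univ_poly (fun t => a * horner l2 t + horner (0 :: l) t).
    by apply: univ_poly_add => //; exists (0 :: l).
  by exists l3 => t; rewrite -H3 /= -Hl; ring.
by exists l => t; rewrite H1 H2 Hl.
Qed.

Lemma continuity_horner (l : seq R) : continuity (horner l).
Proof.
elim: l => [|a l IH] /=; first by apply: continuity_const => x y.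
apply: (continuity_plus (fct_cte a) (id * horner l)%F).
  by apply: continuity_const => x y.
by apply: continuity_mult => //; apply: derivable_continuous; apply: derivable_id.
Qed.

(** Induction on the coefficients: a zero constant term lets a factor [t] be removed, and a nonzero
    one keeps the value away from zero near the origin by continuity. *)
Lemma univ_poly_isolated_zero (f : R -> R) (t1 : R) :
  univ_poly f -> f t1 <> 0 ->
  exists e, 0 < e /\ forall t, 0 < t < e -> f t <> 0.
Proof.
move=> [l Hl]; rewrite Hl => H.
have [e [e0 He]] : exists e, 0 < e /\ forall t, 0 < t < e -> horner l t <> 0.
  elim: l {Hl} H => [|a l IH] //= H.
  case: (Req_dec a 0) H => [->|a0] H.
    have [|e [e0 He]] := IH; first by move=> E; apply: H; rewrite E; ring.
    exists e; split => // t Ht; rewrite Rplus_0_l.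
    by apply: Rmult_integral_contrapositive; split; [lra|apply: He].
  have /continuity_pt_epsP /(_ (Rabs a) (Rabs_pos_lt _ a0)) [e [e0 He]] :=
    continuity_horner (a :: l) 0.
  exists e; split => // t Ht E.
  have := He t; rewrite /= E Rminus_0_r Rabs_pos_eq; last lra.
  replace (0 - (a + 0 * horner l 0)) with (- a) by ring.
  by rewrite Rabs_Ropp => /(_ ltac:(lra)); lra.
by exists e; split => // t /He; rewrite Hl.
Qed.

(** * Boxes and pointwise continuity *)

Definition box n (x : pt n) (d : R) (y : pt n) : Prop :=
  forall i, Rabs (y i - x i) < d.

Definition cont_at n (g : pt n -> R) (x : pt n) : Prop :=
  forall eps, 0 < eps -> exists delta, 0 < delta /\
    forall y, box n x delta y -> Rabs (g y - g x) < eps.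

Arguments box {n}.
Arguments cont_at {n}.

Lemma box_refl n (x : pt n) (d : R) : 0 < d -> box x d x.
Proof. by move=> d0 i; rewrite Rminus_diag Rabs_R0. Qed.

Lemma box_le n (x y : pt n) (d e : R) : d <= e -> box x d y -> box x e y.
Proof. by move=> de H i; apply: Rlt_le_trans (H i) de. Qed.

Lemma box_trans n (x y z : pt n) (d e : R) :
  box x d y -> box y e z -> box x (d + e) z.
Proof.
move=> H1 H2 i; have := Rabs_triang (z i - y i) (y i - x i).
replace (z i - y i + (y i - x i)) with (z i - x i) by ring.
move: (H1 i) (H2 i); lra.
Qed.

Lemma shift0 n (x : pt n) i : shift x i 0 = x.
Proof. by apply: functional_extensionality => j; rewrite /shift Rplus_0_r; case: eqP. Qed.

Lemma shift_shift n (x : pt n) i s t : shift (shift x i s) i t = shift x i (s + t).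
Proof. by apply: functional_extensionality => j; rewrite /shift; case: eqP => // _; ring. Qed.

Lemma box_shift n (x y : pt n) i t d : box x d y -> box (shift x i t) d (shift y i t).
Proof.
move=> H j; rewrite /shift; case: eqP => _ //.
by replace (y j + t - (x j + t)) with (y j - x j) by ring.
Qed.

Lemma box_shift_self n (x : pt n) i s t d :
  Rabs (s - t) < d -> box (shift x i t) d (shift x i s).
Proof.
move=> H j; rewrite /shift; case: eqP => _.
  by replace (x j + s - (x j + t)) with (s - t) by ring.
by rewrite Rminus_diag Rabs_R0; move: (Rabs_pos (s - t)); lra.
Qed.

Lemma cont_at_const n (c : R) (x : pt n) : cont_at (fun _ => c) x.
Proof. by move=> e e0; exists 1; split; [lra|move=> y _; rewrite Rminus_diag Rabs_R0]. Qed.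

Lemma cont_at_comp n (phi : R -> R) (g : pt n -> R) (x : pt n) :
  cont_at g x -> continuity_pt phi (g x) -> cont_at (fun y => phi (g y)) x.
Proof.
move=> cg /continuity_pt_epsP cphi e e0.
have [d [d0 Hd]] := cphi e e0; have [d' [d'0 Hd']] := cg d d0.
by exists d'; split => // y Hy; apply: Hd; apply: Hd'.
Qed.

Lemma cont_at_add n (f g : pt n -> R) (x : pt n) :
  cont_at f x -> cont_at g x -> cont_at (fun y => f y + g y) x.
Proof.
move=> cf cg e e0.
have [d [d0 Hd]] := cf (e / 2) ltac:(lra); have [d' [d'0 Hd']] := cg (e / 2) ltac:(lra).
exists (Rmin d d'); split; first exact: Rmin_pos.
move=> y Hy.
have H1 := Hd y (box_le _ _ _ _ _ (Rmin_l d d') Hy).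
have H2 := Hd' y (box_le _ _ _ _ _ (Rmin_r d d') Hy).
replace (f y + g y - (f x + g x)) with ((f y - f x) + (g y - g x)) by ring.
have := Rabs_triang (f y - f x) (g y - g x); lra.
Qed.

Lemma continuity_scal_l (a : R) : continuity (fun t => a * t).
Proof.
by apply: (continuity_scal id); apply: derivable_continuous; apply: derivable_id.
Qed.

Lemma cont_at_scal n (a : R) (f : pt n -> R) (x : pt n) :
  cont_at f x -> cont_at (fun y => a * f y) x.
Proof. by move=> cf; apply: (cont_at_comp _ (fun t => a * t)) => //; apply: continuity_scal_l. Qed.

Lemma cont_at_mul n (f g : pt n -> R) (x : pt n) :
  cont_at f x -> cont_at g x -> cont_at (fun y => f y * g y) x.
Proof.
have csq (u : pt n -> R) : cont_at u x -> cont_at (fun y => Rsqr (u y)) x.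
  move=> cu; apply: cont_at_comp => //.
  by apply: derivable_continuous_pt; apply: derivable_Rsqr.
move=> cf cg.
(* Polarization reduces products to squares, which are compositions with a continuous function of
   one variable. *)
have -> : (fun y => f y * g y) =
   (fun y => / 4 * (Rsqr (f y + g y) + -1 * Rsqr (f y + -1 * g y))).
  by apply: functional_extensionality => y; rewrite /Rsqr; field.
apply: cont_at_scal; apply: cont_at_add; first by apply: csq; apply: cont_at_add.
by apply: cont_at_scal; apply: csq; apply: cont_at_add => //; apply: cont_at_scal.
Qed.

Lemma cont_at_div n (f g : pt n -> R) (x : pt n) :
  cont_at f x -> cont_at g x -> g x <> 0 -> cont_at (fun y => f y / g y) x.
Proof.
move=> cf cg g0; apply: cont_at_mul => //; apply: cont_at_comp => //.
by apply: (continuity_pt_inv id) => //; apply: derivable_continuous_pt; apply: derivable_pt_id.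
Qed.

Lemma cont_at_neq0 n (f : pt n -> R) (x : pt n) :
  cont_at f x -> f x <> 0 -> exists d, 0 < d /\ forall y, box x d y -> f y <> 0.
Proof.
move=> cf f0; have [d [d0 Hd]] := cf _ (Rabs_pos_lt _ f0).
exists d; split => // y /Hd H E; move: H; rewrite E.
by rewrite Rminus_0_l Rabs_Ropp; lra.
Qed.

Lemma cont_at_line n (g : pt n -> R) (x : pt n) i t :
  cont_at g (shift x i t) -> continuity_pt (fun s => g (shift x i s)) t.
Proof.
move=> cg; apply/continuity_pt_epsP => e /cg [d [d0 Hd]].
by exists d; split => // s Hs; apply: Hd; apply: box_shift_self.
Qed.

(** Used to make radii uniform over the finitely many coordinates: a property inherited by smaller
    scales holds for all indices at the minimum of their scales. *)
Lemma finite_common_scale (T : finType) (P : T -> R -> Prop) :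
  (forall j d e, 0 < d -> d <= e -> P j e -> P j d) ->
  (forall j, exists d, 0 < d /\ P j d) ->
  exists d, 0 < d /\ forall j, P j d.
Proof.
move=> mono H.
have [d [d0 Hd]] : exists d, 0 < d /\ forall j, j \in enum T -> P j d.
  elim: (enum T) => [|i s [d [d0 Hd]]]; first by exists 1; split => //; lra.
  have [e [e0 He]] := H i.
  exists (Rmin d e); split; first exact: Rmin_pos.
  move=> j; rewrite in_cons => /orP [/eqP ->|js].
    by apply: mono He; [apply: Rmin_pos|apply: Rmin_r].
  by apply: mono (Hd j js); [apply: Rmin_pos|apply: Rmin_l].
by exists d; split => // j; apply: Hd; rewrite mem_enum.
Qed.

(** * Polynomial functions *)

Lemma cont_at_poly n (p : pt n -> R) (x : pt n) : is_poly p -> cont_at p x.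
Proof.
elim=> [c|i|p1 p2 _ H1 _ H2|p1 p2 _ H1 _ H2].
- exact: cont_at_const.
- by move=> e e0; exists e; split.
- exact: cont_at_add.
- exact: cont_at_mul.
Qed.

Lemma poly_scal n (c : R) (p : pt n -> R) : is_poly p -> is_poly (fun x => c * p x).
Proof. by move=> pp; apply: poly_mul => //; apply: poly_const. Qed.

Lemma poly_sub n (p q : pt n -> R) :
  is_poly p -> is_poly q -> is_poly (fun x => p x - q x).
Proof.
move=> pp pq.
have -> : (fun x => p x - q x) = (fun x => p x + -1 * q x).
  by apply: functional_extensionality => x; ring.
by apply: poly_add => //; apply: poly_scal.
Qed.

Lemma poly_pow n (p : pt n -> R) (e : nat) : is_poly p -> is_poly (fun x => p x ^ e).
Proof. by move=> pp; elim: e => [|e IH] /=; [apply: poly_const|apply: poly_mul]. Qed.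

Lemma poly_translate n (p : pt n -> R) (c : pt n) :
  is_poly p -> is_poly (fun v => p (fun j => c j + v j)).
Proof.
elim=> [a|i|p1 p2 _ H1 _ H2|p1 p2 _ H1 _ H2].
- exact: poly_const.
- by apply: poly_add; [apply: poly_const|apply: poly_coord].
- exact: poly_add.
- exact: poly_mul.
Qed.

Lemma univ_poly_curve n (p : pt n -> R) (gamma : R -> pt n) :
  is_poly p -> (forall j, univ_poly (fun t => gamma t j)) ->
  univ_poly (fun t => p (gamma t)).
Proof.
move=> + Hg; elim=> [a|i|p1 p2 _ H1 _ H2|p1 p2 _ H1 _ H2].
- by exists [:: a] => t /=; ring.
- exact: Hg.
- exact: univ_poly_add.
- exact: univ_poly_mul.
Qed.

Lemma poly_isolated_zero_line n (p : pt n -> R) (x : pt n) i t0 :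
  is_poly p -> p (shift x i t0) <> 0 ->
  forall s, exists e, 0 < e /\ forall t, s < t < s + e -> p (shift x i t) <> 0.
Proof.
move=> pp H s.
have [||e [e0 He]] := univ_poly_isolated_zero (fun t => p (shift x i (s + t))) (t0 - s).
- apply: univ_poly_curve => // j; rewrite /shift; case: eqP => _.
    by exists [:: x j + s; 1] => t /=; ring.
  by exists [:: x j] => t /=; ring.
- by replace (s + (t0 - s)) with t0 by ring.
exists e; split => // t Ht; have := He (t - s) ltac:(lra).
by replace (s + (t - s)) with t by ring.
Qed.

(** Restricted to the segment from [x] towards a point [z] with [p z <> 0], [p] is a univariate
    polynomial that is nonzero at parameter 1, so it does not vanish at small positive
    parameters. *)
Lemma poly_neq0_dense n (p : pt n -> R) :
  is_poly p -> (exists z, p z <> 0) ->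
  forall x d, 0 < d -> exists y, box x d y /\ p y <> 0.
Proof.
move=> pp [z pz] x d d0.
have [||e [e0 He]] := univ_poly_isolated_zero (fun t => p (fun j => x j + t * (z j - x j))) 1.
- apply: univ_poly_curve => // j.
  by exists [:: x j; z j - x j] => t /=; ring.
- by replace (fun j => _) with z by (apply: functional_extensionality => j; ring).
have [d' [d'0 Hd']] : exists d', 0 < d' /\
    forall j, Rabs (d' * (z j - x j)) < d.
  apply: (finite_common_scale 'I_n (fun j d' => Rabs (d' * (z j - x j)) < d)).
    move=> j a b a0 ab; rewrite !Rabs_mult (Rabs_pos_eq a) ?(Rabs_pos_eq b); try lra.
    by apply: Rle_lt_trans; apply: Rmult_le_compat_r => //; apply: Rabs_pos.
  (* The added 1 keeps the denominator positive when [z j = x j] and makes the bound strict. *)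
  move=> j; exists (d / (Rabs (z j - x j) + 1)).
  have H := Rabs_pos (z j - x j).
  have H0 : 0 < d / (Rabs (z j - x j) + 1) by apply: Rdiv_lt_0_compat; lra.
  split => //; rewrite Rabs_mult (Rabs_pos_eq (_ / _)); last lra.
  have E : d / (Rabs (z j - x j) + 1) * (Rabs (z j - x j) + 1) = d by field; lra.
  lra.
set t := Rmin d' (e / 2).
have t0 : 0 < t by apply: Rmin_pos; lra.
exists (fun j => x j + t * (z j - x j)); split; last first.
  by apply: He; have := Rmin_r d' (e / 2); rewrite -/t; lra.
move=> j; replace (_ - _) with (t * (z j - x j)) by ring.
apply: Rle_lt_trans (Hd' j).
rewrite !Rabs_mult (Rabs_pos_eq t) ?(Rabs_pos_eq d'); try lra.
by apply: Rmult_le_compat_r; [apply: Rabs_pos|apply: Rmin_l].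
Qed.

Lemma poly_mul_neq0 n (p q : pt n -> R) :
  is_poly p -> is_poly q -> (exists x, p x <> 0) -> (exists x, q x <> 0) ->
  exists x, p x * q x <> 0.
Proof.
move=> pp pq [x px] q0.
have [d [d0 Hd]] := cont_at_neq0 _ _ _ (cont_at_poly _ _ x pp) px.
have [y [Hy qy]] := poly_neq0_dense _ _ pq q0 x d d0.
by exists y; apply: Rmult_integral_contrapositive; split => //; apply: Hd.
Qed.

Lemma poly_pow_neq0 n (p : pt n -> R) (e : nat) :
  (exists x, p x <> 0) -> exists x, p x ^ e <> 0.
Proof. by move=> [x px]; exists x; apply: pow_nonzero. Qed.

Lemma poly_cancel n (r p q : pt n -> R) :
  is_poly r -> is_poly p -> is_poly q -> (exists x, r x <> 0) ->
  (forall x, r x * p x = r x * q x) -> forall x, p x = q x.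
Proof.
move=> pr pp pq r0 H x; apply: NNPP => ne.
have [|y Hy] := poly_mul_neq0 _ _ _ pr (poly_sub _ _ _ pp pq) r0.
  by exists x; lra.
by apply: Hy; rewrite Rmult_minus_distr_l H; ring.
Qed.

Lemma eq_of_dense n (r g1 g2 : pt n -> R) (x : pt n) :
  is_poly r -> (exists x, r x <> 0) -> cont_at g1 x -> cont_at g2 x ->
  (forall y, r y <> 0 -> g1 y = g2 y) -> g1 x = g2 x.
Proof.
move=> pr r0 c1 c2 H; apply: Rminus_diag_uniq.
have c : cont_at (fun y => g1 y + -1 * g2 y) x.
  by apply: cont_at_add => //; apply: cont_at_scal.
apply: NNPP => ne.
have [|d [d0 Hd]] := cont_at_neq0 _ _ _ c; first lra.
have [y [Hy ry]] := poly_neq0_dense _ _ pr r0 x d d0.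
by apply: (Hd y Hy); rewrite H //; ring.
Qed.

(** The product of the first [N] polynomials is again nonzero, so it has nonzeros arbitrarily close
    to the origin. *)
Lemma poly_family_generic n (s : nat -> pt n -> R) (N : nat) :
  (forall m, is_poly (s m)) -> (forall m, exists x, s m x <> 0) ->
  forall d, 0 < d -> exists v, box (fun _ => 0) d v /\
    forall m, (m < N)%nat -> s m v <> 0.
Proof.
move=> ps s0 d d0.
have [P [pP [P0 HP]]] : exists P, is_poly P /\ (exists x, P x <> 0) /\
   forall v, P v <> 0 -> forall m, (m < N)%nat -> s m v <> 0.
  elim: N => [|N [P [pP [P0 HP]]]].
    exists (fun _ => 1); split; first exact: poly_const.
    by split => //; exists (fun _ => 0); lra.
  exists (fun x => P x * s N x); split; first exact: poly_mul.
  split; first exact: poly_mul_neq0.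
  move=> v Hv m; rewrite ltnS leq_eqVlt => /orP [/eqP ->|mN].
    by move=> E; apply: Hv; rewrite E; ring.
  by apply: HP => // E; apply: Hv; rewrite E; ring.
have [v [Hv Pv]] := poly_neq0_dense _ _ pP P0 (fun _ => 0) d d0.
by exists v; split => //; apply: HP.
Qed.

(** * Partial derivatives and restriction to coordinate lines *)

Lemma derivable_pt_lim_shift (f : R -> R) (t l : R) :
  derivable_pt_lim (fun s => f (t + s)) 0 l <-> derivable_pt_lim f t l.
Proof.
by split => H eps eps0; have [d Hd] := H eps eps0; exists d => h h0 hd;
  move: (Hd h h0 hd); rewrite Rplus_0_l Rplus_0_r.
Qed.

Lemma partial_line n (F : pt n -> R) i (x : pt n) t l :
  partial_at F i (shift x i t) l <-> derivable_pt_lim (fun s => F (shift x i s)) t l.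
Proof.
rewrite -derivable_pt_lim_shift /partial_at.
by split; apply: derivable_pt_lim_ext => s; rewrite shift_shift.
Qed.

Lemma poly_partial n (p : pt n -> R) (i : 'I_n) :
  is_poly p -> exists dp, is_poly dp /\ forall x, partial_at p i x (dp x).
Proof.
elim=> [c|j|p1 p2 P1 [d1 [Pd1 H1]] P2 [d2 [Pd2 H2]]|p1 p2 P1 [d1 [Pd1 H1]] P2 [d2 [Pd2 H2]]].
- exists (fun _ => 0); split; first exact: poly_const.
  by move=> x; apply: derivable_pt_lim_const.
- exists (fun _ => if j == i then 1 else 0); split.
    by case: eqP => _; apply: poly_const.
  move=> x; rewrite /partial_at /shift; case: eqP => _; last exact: derivable_pt_lim_const.
  rewrite -[X in derivable_pt_lim _ _ X]Rplus_0_l.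
  apply: (derivable_pt_lim_plus (fct_cte (x j)) id); first exact: derivable_pt_lim_const.
  exact: derivable_pt_lim_id.
- exists (fun x => d1 x + d2 x); split; first exact: poly_add.
  by move=> x; apply: derivable_pt_lim_plus; [apply: H1|apply: H2].
- exists (fun x => d1 x * p2 x + p1 x * d2 x); split.
    by apply: poly_add; apply: poly_mul.
  move=> x; have := derivable_pt_lim_mult _ _ _ _ _ (H1 x) (H2 x).
  by rewrite !shift0.
Qed.

Lemma partial_ext n (F G : pt n -> R) i (x : pt n) d l : 0 < d ->
  (forall y, box x d y -> F y = G y) -> partial_at F i x l -> partial_at G i x l.
Proof.
move=> d0 H; apply: (derivable_pt_lim_locally_ext _ _ _ (-d) d); first lra.
move=> t Ht; apply: H; rewrite -{1}(shift0 _ x i); apply: box_shift_self.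
by rewrite Rminus_0_r; apply: Rabs_def1; lra.
Qed.

(** * Elimination of one variable *)

Definition indep n (j : 'I_n) (a : pt n -> R) : Prop :=
  is_poly a /\ forall x t, a (shift x j t) = a x.

(** Polynomials in [x_j] over the ring of polynomials in the other variables, with the top
    coefficient split off first. That coefficient may be zero, so [d] is only a strict upper bound
    on the degree, and [d = 0] leaves just the zero polynomial. *)
Fixpoint deg_lt n (j : 'I_n) (d : nat) (p : pt n -> R) : Prop :=
  if d is d'.+1 then
    exists a, indep n j a /\ deg_lt n j d' (fun x => p x - a x * x j ^ d')
  else forall x, p x = 0.

Arguments indep {n}.
Arguments deg_lt {n}.

Lemma indep_const n (j : 'I_n) c : indep j (fun _ => c).
Proof. by split => //; apply: poly_const. Qed.

Lemma indep_add n (j : 'I_n) a b : indep j a -> indep j b -> indep j (fun x => a x + b x).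
Proof. by move=> [pa ia] [pb ib]; split; [apply: poly_add|move=> x t; rewrite ia ib]. Qed.

Lemma indep_mul n (j : 'I_n) a b : indep j a -> indep j b -> indep j (fun x => a x * b x).
Proof. by move=> [pa ia] [pb ib]; split; [apply: poly_mul|move=> x t; rewrite ia ib]. Qed.

Lemma indep_pow n (j : 'I_n) a e : indep j a -> indep j (fun x => a x ^ e).
Proof. by move=> [pa ia]; split; [apply: poly_pow|move=> x t; rewrite ia]. Qed.

Lemma deg_lt_ext n (j : 'I_n) d p q : (forall x, p x = q x) -> deg_lt j d p -> deg_lt j d q.
Proof. by move=> /functional_extensionality ->. Qed.

Lemma deg_lt_add n (j : 'I_n) d p q :
  deg_lt j d p -> deg_lt j d q -> deg_lt j d (fun x => p x + q x).
Proof.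
elim: d p q => [|d IH] p q /=; first by move=> H1 H2 x; rewrite H1 H2; ring.
move=> [a [ia Ha]] [b [ib Hb]]; exists (fun x => a x + b x); split; first exact: indep_add.
by apply: deg_lt_ext (IH _ _ Ha Hb) => x; ring.
Qed.

Lemma deg_lt_scal n (j : 'I_n) d b p :
  indep j b -> deg_lt j d p -> deg_lt j d (fun x => b x * p x).
Proof.
move=> ib; elim: d p => [|d IH] p /=; first by move=> H1 x; rewrite H1; ring.
move=> [a [ia Ha]]; exists (fun x => b x * a x); split; first exact: indep_mul.
by apply: deg_lt_ext (IH _ Ha) => x; ring.
Qed.

Lemma deg_lt_S n (j : 'I_n) d p : deg_lt j d p -> deg_lt j d.+1 p.
Proof.
move=> H; exists (fun _ => 0); split; first exact: indep_const.
by apply: deg_lt_ext H => x; ring.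
Qed.

Lemma deg_lt_addn n (j : 'I_n) d e p : deg_lt j d p -> deg_lt j (e + d) p.
Proof. by elim: e => [//|e IH] H; rewrite addSn; apply: deg_lt_S; apply: IH. Qed.

Lemma deg_lt_mulXn n (j : 'I_n) d e p :
  deg_lt j d p -> deg_lt j (e + d) (fun x => x j ^ e * p x).
Proof.
have mulX m r : deg_lt j m r -> deg_lt j m.+1 (fun x => x j * r x).
  elim: m r => [|m IH] r H.
    exists (fun _ => 0); split; first exact: indep_const.
    by move=> x /=; rewrite (H x); ring.
  case: H => a [ia Ha]; exists a; split => //.
  by apply: deg_lt_ext (IH _ Ha) => x /=; ring.
move=> H; elim: e => [|e IH]; first by apply: deg_lt_ext H => x /=; ring.
by rewrite addSn; apply: deg_lt_ext (mulX _ _ IH) => x /=; ring.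
Qed.

Lemma deg_lt_exists n (j : 'I_n) p : is_poly p -> exists d, deg_lt j d p.
Proof.
have add d e q r : deg_lt j d q -> deg_lt j e r -> deg_lt j (d + e) (fun x => q x + r x).
  move=> Hq Hr; apply: deg_lt_add; last exact: deg_lt_addn.
  by rewrite addnC; apply: deg_lt_addn.
have cst a : indep j a -> deg_lt j 1 a.
  by move=> ia; exists a; split => // x /=; ring.
elim=> [c|i|q r _ [d Hq] _ [e Hr]|q r _ [d Hq] _ [e Hr]].
- by exists 1%nat; apply: cst; apply: indep_const.
- case: (eqVneq i j) => [->|ij].
    exists 2%nat.
    by apply: deg_lt_ext (deg_lt_mulXn _ _ _ 1 _ (cst _ (indep_const _ j 1))) => x /=; ring.
  exists 1%nat; apply: cst; split; first exact: poly_coord.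
  by move=> x t; rewrite /shift (negbTE ij).
- by exists (d + e)%nat; apply: add.
(* For a product, induct on the degree bound of the first factor, splitting off its top term
   [a x * x j ^ d] at each stage. *)
- elim: d q Hq => [|d IH] q; first by move=> H; exists 0%nat => x; rewrite (H x); ring.
  case=> a [ia Ha]; have [m Hm] := IH _ Ha.
  exists (m + (d + e))%nat.
  apply: deg_lt_ext (add _ _ _ _ Hm (deg_lt_scal _ _ _ _ _ ia (deg_lt_mulXn _ _ _ d _ Hr))).
  by move=> x; ring.
Qed.

(** The leading coefficient [a] of [w] need not be invertible, so each division step first
    multiplies by [a]; the exponent [e] counts these steps. *)
Lemma pseudo_division n (j : 'I_n) a d w :
  indep j a -> is_poly w -> deg_lt j d (fun x => w x - a x * x j ^ d) ->
  forall p, is_poly p ->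
  exists e s, is_poly s /\ deg_lt j d (fun x => a x ^ e * p x - s x * w x).
Proof.
move=> ia pw Hw p pp; have [m Hm] := deg_lt_exists _ j _ pp.
elim: m p {pp} Hm => [|m IH] p Hp.
  exists 0%nat, (fun _ => 0); split; first exact: poly_const.
  by rewrite -[d]addn0; apply: deg_lt_addn => x; rewrite (Hp x) /=; ring.
case: (ltnP m d) => md.
  exists 0%nat, (fun _ => 0); split; first exact: poly_const.
  rewrite -(subnK md); apply: deg_lt_addn.
  by apply: deg_lt_ext Hp => x /=; ring.
case: Hp => b [ib Hb].
(* Subtracting this multiple of [w] cancels the term of degree [m] in [a * p], which lowers the
   degree bound by one. *)
have [|e [s [ps Hs]]] := IH (fun x => a x * p x - b x * x j ^ (m - d) * w x).
  apply: (deg_lt_ext _ _ _ (fun x => a x * (p x - b x * x j ^ m) +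
     -1 * (b x * (x j ^ (m - d) * (w x - a x * x j ^ d))))).
    move=> x; have -> : x j ^ m = x j ^ (m - d) * x j ^ d.
      by rewrite -pow_add plusE subnK.
    ring.
  apply: deg_lt_add; first exact: deg_lt_scal.
  apply: deg_lt_scal; first exact: indep_const.
  apply: deg_lt_scal => //.
  by rewrite -{1}(subnK md); apply: deg_lt_mulXn.
exists e.+1, (fun x => s x + a x ^ e * (b x * x j ^ (m - d))); split.
  apply: poly_add => //; apply: poly_mul; first by apply: poly_pow; apply: (proj1 ia).
  by apply: poly_mul; [apply: (proj1 ib)|apply: poly_pow; apply: poly_coord].
by apply: deg_lt_ext Hs => x /=; ring.
Qed.

Lemma least_nat (P : nat -> Prop) :
  (exists m, P m) -> exists m, P m /\ forall e, (e < m)%nat -> ~ P e.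
Proof.
move=> [m Pm]; apply: NNPP => H.
suff : forall e, ~ P e by move=> /(_ m).
move=> e; elim/ltn_ind: e => e IH Pe; apply: H; exists e; split => //.
Qed.

(* An element [w] of least [x_j]-degree in the ideal [(P, Q)] divides [P] and
   [Q] up to powers of its leading coefficient; dividing by it makes [P] and
   [Q] coprime over the field of rational functions in the other variables. *)
Lemma coprime_representative n (j : 'I_n) (P Q : pt n -> R) :
  is_poly P -> is_poly Q -> (exists x, Q x <> 0) ->
  exists p' q' u v r, is_poly p' /\ is_poly q' /\ indep j r /\
    (exists x, r x <> 0) /\ (forall x, p' x * Q x = P x * q' x) /\
    (forall x, u x * p' x + v x * q' x = r x).
Proof.
move=> pP pQ Q0.
pose I w := exists u v, is_poly u /\ is_poly v /\ forall x, w x = u x * P x + v x * Q x.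
have [|d [[w [[u [v [pu [pv wE]]]] [w0 Hw]]] dmin]] :=
  least_nat (fun d => exists w, I w /\ (exists x, w x <> 0) /\ deg_lt j d w).
  have [d Hd] := deg_lt_exists _ j _ pQ.
  exists d, Q; split => //; exists (fun _ => 0), (fun _ => 1).
  by split; [apply: poly_const|split; [apply: poly_const|move=> x; ring]].
case: d dmin Hw => [|d] dmin Hw; first by case: w0 => x; rewrite (Hw x).
case: Hw => a [ia Ha].
have pw : is_poly w.
  have -> : w = (fun x => u x * P x + v x * Q x) by apply: functional_extensionality.
  by apply: poly_add; apply: poly_mul.
have pa := proj1 ia.
(* If [a] were identically zero, [w] would satisfy the smaller degree bound [d], against
   minimality. *)
have a0 : exists x, a x <> 0.
  apply: NNPP => na; apply: (dmin d) => //; exists w; split; first by exists u, v.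
  split => //; apply: deg_lt_ext Ha => x.
  have -> : a x = 0 by apply: NNPP => ax; apply: na; exists x.
  ring.
have divides p : is_poly p -> I p ->
    exists e s, is_poly s /\ forall x, a x ^ e * p x = s x * w x.
  move=> pp [u1 [v1 [pu1 [pv1 pE]]]].
  have [e [s [ps Hs]]] := pseudo_division _ _ _ _ _ ia pw Ha _ pp.
  (* The pseudo-remainder lies in the ideal and has a smaller degree bound than [w], so minimality
     forces it to vanish. *)
  exists e, s; split => // x; apply: Rminus_diag_uniq; apply: NNPP => nz.
  apply: (dmin d) => //; exists (fun x => a x ^ e * p x - s x * w x).
  split; last by split => //; exists x.
  exists (fun x => a x ^ e * u1 x - s x * u x), (fun x => a x ^ e * v1 x - s x * v x).
  have pae := poly_pow _ _ e pa.
  split; first by apply: poly_sub; apply: poly_mul.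
  split; first by apply: poly_sub; apply: poly_mul.
  by move=> y; rewrite pE wE; ring.
have [|e1 [s1 [ps1 H1]]] := divides P pP.
  exists (fun _ => 1), (fun _ => 0).
  by split; [apply: poly_const|split; [apply: poly_const|move=> x; ring]].
have [|e2 [s2 [ps2 H2]]] := divides Q pQ.
  exists (fun _ => 0), (fun _ => 1).
  by split; [apply: poly_const|split; [apply: poly_const|move=> x; ring]].
have pa1 := poly_pow _ _ e1 pa; have pa2 := poly_pow _ _ e2 pa.
have pp' : is_poly (fun x => a x ^ e2 * s1 x) by apply: poly_mul.
have pq' : is_poly (fun x => a x ^ e1 * s2 x) by apply: poly_mul.
(* With these witnesses, [p' w = r P] and [q' w = r Q] for [r = a ^ (e1 + e2)]. Both required
   identities therefore hold after multiplication by [w], which is then cancelled. *)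
exists (fun x => a x ^ e2 * s1 x), (fun x => a x ^ e1 * s2 x), u, v,
  (fun x => a x ^ e1 * a x ^ e2).
split => //; split => //.
split; first by apply: indep_mul; apply: indep_pow.
split; first by apply: poly_mul_neq0 => //; apply: poly_pow_neq0.
split.
- apply: (poly_cancel _ w _ _ pw (poly_mul pp' pQ) (poly_mul pP pq') w0) => x.
  transitivity (a x ^ e2 * (s1 x * w x) * Q x); first ring.
  transitivity (a x ^ e1 * P x * (s2 x * w x)); last ring.
  by rewrite -H1 -H2; ring.
- apply: (poly_cancel _ w _ _ pw _ (poly_mul pa1 pa2) w0).
    by apply: poly_add; apply: poly_mul.
  move=> x.
  transitivity (u x * a x ^ e2 * (s1 x * w x) + v x * a x ^ e1 * (s2 x * w x)); first ring.
  by rewrite -H1 -H2 wE; ring.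
Qed.

(** * Mean values along generic coordinate lines *)

(** The denominator [Q] may differ from [q]: differentiation squares [Q], while the set [q <> 0]
    stays fixed through the induction on the order. *)
Definition rational_on n (q F : pt n -> R) : Prop :=
  exists P Q, is_poly P /\ is_poly Q /\ (forall x, q x <> 0 -> Q x <> 0) /\
    forall x, q x <> 0 -> F x = P x / Q x.

Definition mean_value_at n (q F : pt n -> R) (h : pt n -> R) (j : 'I_n) (y : pt n) : Prop :=
  forall t, q y <> 0 -> q (shift y j t) <> 0 ->
  exists c, (0 <= c <= t \/ t <= c <= 0) /\
    F (shift y j t) - F y = t * h (shift y j c).

Arguments rational_on {n}.
Arguments mean_value_at {n}.

Lemma rational_partial n (q F : pt n -> R) (i : 'I_n) :
  is_poly q -> rational_on q F ->
  exists G, rational_on q G /\ forall x, q x <> 0 -> partial_at F i x (G x).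
Proof.
move=> pq [P [Q [pP [pQ [Q0 FE]]]]].
have [dP [pdP HP]] := poly_partial _ _ i pP.
have [dQ [pdQ HQ]] := poly_partial _ _ i pQ.
exists (fun x => (dP x * Q x - dQ x * P x) / Rsqr (Q x)); split.
  exists (fun x => dP x * Q x - dQ x * P x), (fun x => Q x * Q x).
  split; first by apply: poly_sub; apply: poly_mul.
  split; first exact: poly_mul.
  by split => // x /Q0 Qx; apply: Rmult_integral_contrapositive.
move=> x qx.
have [d [d0 Hd]] := cont_at_neq0 _ _ _ (cont_at_poly _ _ x pq) qx.
apply: (partial_ext _ (fun x => P x / Q x) F i x d) => //.
  by move=> y /Hd qy; rewrite FE.
have := derivable_pt_lim_div _ _ _ _ _ (HP x) (HQ x); rewrite !shift0.
by apply; apply: Q0.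
Qed.

(** The polynomial [r] comes from the Bezout relation of a representative coprime in [x_j]. As [r]
    does not involve [x_j], the condition [r y <> 0] is a condition on the whole line through [y] in
    direction [j], and there it excludes common zeros of [p'] and [q']. *)
Lemma generic_mean_value n (q F h : pt n -> R) (j : 'I_n) :
  is_poly q -> (exists x, q x <> 0) -> rational_on q F ->
  (forall x, q x <> 0 -> partial_at F j x (h x)) -> continuous_on_Rn h ->
  exists r, is_poly r /\ (exists x, r x <> 0) /\
    forall y, r y <> 0 -> mean_value_at q F h j y.
Proof.
move=> pq q0 [P [Q [pP [pQ [Q0 FE]]]]] dF ch.
have Qne0 : exists x, Q x <> 0 by case: q0 => x /Q0; exists x.
have [p' [q' [u [v [r [pp' [pq' [[pr ir] [r0 [E1 E2]]]]]]]]]] :=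
  coprime_representative _ j _ _ pP pQ Qne0.
exists r; split => //; split => // y ry t qy qt.
have [dp [pdp Hdp]] := poly_partial _ _ j pp'.
have [dq [pdq Hdq]] := poly_partial _ _ j pq'.
have cl g : is_poly g -> continuity (fun t => g (shift y j t)).
  by move=> pg s; apply: cont_at_line; apply: cont_at_poly.
have mvt := mean_value_through_zeros (fun t => q (shift y j t) <> 0)
  (fun t => F (shift y j t)) (fun t => h (shift y j t))
  (fun t => p' (shift y j t)) (fun t => q' (shift y j t))
  (fun t => dp (shift y j t)) (fun t => dq (shift y j t)).
have {}mvt : forall s t, q (shift y j s) <> 0 -> q (shift y j t) <> 0 -> s < t ->
    exists c, s <= c <= t /\
      F (shift y j t) - F (shift y j s) = (t - s) * h (shift y j c).
  apply: mvt.
  - by apply: (poly_isolated_zero_line _ _ _ _ t).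
  - move=> s qs.
    have [d [d0 Hd]] := cont_at_neq0 _ _ _ (cont_at_poly _ _ _ pq) qs.
    by exists d; split => // s' Hs'; apply: Hd; apply: box_shift_self.
  - by move=> s qs; apply/partial_line; apply: dF.
  - by move=> s; apply: cont_at_line; apply: ch.
  - by move=> s; apply/partial_line.
  - by move=> s; apply/partial_line.
  - exact: cl.
  - exact: cl.
  - move=> s qs; rewrite FE //; set z := shift y j s.
    have Qz : Q z <> 0 by apply: Q0.
    apply: (Rmult_eq_reg_r (Q z)) => //; rewrite E1; field => //.
  - by move=> s [H1 H2]; apply: ry; rewrite -(ir y s) -E2 H1 H2; ring.
have qy0 : q (shift y j 0) <> 0 by rewrite shift0.
case: (Rtotal_order 0 t) => [t0|[<-|t0]].
- have [c [Hc E]] := mvt 0 t qy0 qt t0.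
  by exists c; split; [left|move: E; rewrite shift0 Rminus_0_r].
- by exists 0; split; [lra|rewrite shift0; ring].
- have [c [Hc E]] := mvt t 0 qt qy0 t0.
  by exists c; split; [right|move: E; rewrite shift0; lra].
Qed.

Lemma finite_generic n (T : finType) (A : T -> pt n -> Prop) :
  (forall j, exists r, is_poly r /\ (exists x, r x <> 0) /\ forall y, r y <> 0 -> A j y) ->
  exists r, is_poly r /\ (exists x, r x <> 0) /\ forall y, r y <> 0 -> forall j, A j y.
Proof.
move=> H.
have [r [pr [r0 Hr]]] : exists r : pt n -> R, is_poly r /\ (exists x, r x <> 0) /\
    forall y, r y <> 0 -> forall j, j \in enum T -> A j y.
  elim: (enum T) => [|i s [r [pr [r0 Hr]]]].
    exists (fun _ => 1); split; first exact: poly_const.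
    by split => //; exists (fun _ => 0); lra.
  have [r1 [pr1 [r10 Hr1]]] := H i.
  exists (fun x => r1 x * r x); split; first exact: poly_mul.
  split; first exact: poly_mul_neq0.
  move=> y Hy j; rewrite in_cons => /orP [/eqP ->|js].
    by apply: Hr1 => E; apply: Hy; rewrite E; ring.
  by apply: Hr => // E; apply: Hy; rewrite E; ring.
by exists r; split => //; split => // y ry j; apply: Hr => //; rewrite mem_enum.
Qed.

(** * Staircase paths with edges parallel to the axes *)

Definition corner n (a b : pt n) (m : nat) : pt n :=
  fun j => if (j < m)%nat then b j else a j.
Arguments corner {n}.

Lemma corner0 n (a b : pt n) : corner a b 0 = a.
Proof. by []. Qed.

Lemma corner_last n (a b : pt n) : corner a b n = b.
Proof. by apply: functional_extensionality => j; rewrite /corner ltn_ord. Qed.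

Lemma cornerS n (a b : pt n) (j : 'I_n) :
  corner a b j.+1 = shift (corner a b j) j (b j - a j).
Proof.
apply: functional_extensionality => i; rewrite /corner /shift ltnS.
case: (eqVneq i j) => [->|ij]; first by rewrite leqnn ltnn; ring.
by rewrite leq_eqVlt (inj_eq val_inj) (negbTE ij).
Qed.

Lemma box_corner n (x a b : pt n) d m : box x d a -> box x d b -> box x d (corner a b m).
Proof. by move=> Ha Hb j; rewrite /corner; case: ifP. Qed.

Lemma box_shift_between n (x y : pt n) j t c d :
  (0 <= c <= t \/ t <= c <= 0) -> box x d y -> box x d (shift y j t) ->
  box x d (shift y j c).
Proof.
move=> Hc H1 H2 i; move: (H1 i) (H2 i); rewrite /shift; case: eqP => // _.
move=> /Rabs_def2 H3 /Rabs_def2 H4; apply: Rabs_def1; lra.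
Qed.

(** Each of the [n] edges has length at most [2 * d] and stays in the box, because boxes are convex
    along coordinate lines; the mean value property bounds the increment on it by [2 * d * M]. *)
Lemma path_bound n (q F : pt n -> R) (h : 'I_n -> pt n -> R) (x a b : pt n) (d M : R) :
  0 <= M -> (forall j z, box x d z -> Rabs (h j z) <= M) ->
  box x d a -> box x d b ->
  (forall m, (m <= n)%nat -> q (corner a b m) <> 0) ->
  (forall m, (m <= n)%nat -> forall j, mean_value_at q F (h j) j (corner a b m)) ->
  Rabs (F b - F a) <= INR n * (2 * d * M).
Proof.
move=> M0 hM Ha Hb qc mc.
suff H m : (m <= n)%nat -> Rabs (F (corner a b m) - F a) <= INR m * (2 * d * M).
  by have := H n (leqnn n); rewrite corner_last.
elim: m => [|m IH] mn; first by rewrite corner0 Rminus_diag Rabs_R0 /=; lra.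
have {}IH := IH (ltnW mn).
pose j := Ordinal mn.
have E : corner a b m.+1 = shift (corner a b m) j (b j - a j) := cornerS n a b j.
have Hm := box_corner _ _ _ _ _ m Ha Hb; have HSm := box_corner _ _ _ _ _ m.+1 Ha Hb.
have qm := qc m (ltnW mn); have qSm := qc m.+1 mn.
rewrite E in qSm HSm *.
have [c [Hc Ec]] := mc m (ltnW mn) j (b j - a j) qm qSm.
have hc := hM j _ (box_shift_between _ _ _ _ _ _ _ Hc Hm HSm).
rewrite S_INR.
have Hba : Rabs (b j - a j) <= 2 * d.
  by move: (Rabs_def2 _ _ (Ha j)) (Rabs_def2 _ _ (Hb j)) => ? ?; apply: Rabs_le; lra.
have step : Rabs (F (shift (corner a b m) j (b j - a j)) - F (corner a b m)) <= 2 * d * M.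
  by rewrite Ec Rabs_mult; apply: Rmult_le_compat => //; apply: Rabs_pos.
have := Rabs_triang (F (shift (corner a b m) j (b j - a j)) - F (corner a b m))
   (F (corner a b m) - F a).
replace (_ - F (corner a b m) + _) with
  (F (shift (corner a b m) j (b j - a j)) - F a) by ring.
lra.
Qed.

(** * Extension across the zeros of the denominator *)

Definition limit_at n (q F : pt n -> R) (x : pt n) (l : R) : Prop :=
  forall eps, 0 < eps -> exists d, 0 < d /\
    forall y, box x d y -> q y <> 0 -> Rabs (F y - l) < eps.
Arguments limit_at {n}.

(** Density of [q <> 0] supplies a sequence tending to [x] on which [F] is Cauchy; its limit is the
    limit along all points of [q <> 0]. *)
Lemma cauchy_limit n (q F : pt n -> R) (x : pt n) :
  is_poly q -> (exists x, q x <> 0) ->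
  (forall eps, 0 < eps -> exists d, 0 < d /\ forall a b, box x d a -> box x d b ->
     q a <> 0 -> q b <> 0 -> Rabs (F a - F b) < eps) ->
  exists l, limit_at q F x l.
Proof.
move=> pq q0 cau.
have [a Ha] : exists a : nat -> pt n, forall m, box x (/ INR m.+1) (a m) /\ q (a m) <> 0.
  apply: (functional_choice (fun m y => box x (/ INR m.+1) y /\ q y <> 0)) => m.
  by apply: poly_neq0_dense => //; apply: Rinv_0_lt_compat; apply: lt_0_INR; lia.
have small d : 0 < d -> exists N, forall m, (m >= N)%coq_nat -> box x d (a m).
  move=> d0; have [N [HN N0]] := archimed_cor1 d d0.
  exists N => m Hm; apply: box_le (proj1 (Ha m)).
  apply: Rle_trans (Rlt_le _ _ HN).
  apply: Rinv_le_contravar; first exact: lt_0_INR.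
  by apply: le_INR; lia.
have [l Hl] : {l | Un_cv (fun m => F (a m)) l}.
  apply: R_complete => eps eps0; have [d [d0 Hd]] := cau eps eps0.
  have [N HN] := small d d0; exists N => m m' Hm Hm'.
  by apply: Hd; try apply: HN => //; apply: (proj2 (Ha _)).
exists l => eps eps0; have [d [d0 Hd]] := cau (eps / 2) ltac:(lra).
exists d; split => // y Hy qy.
have [N HN] := small d d0; have [N' HN'] := Hl (eps / 2) ltac:(lra).
pose m := Nat.max N N'.
have H1 := Hd y (a m) Hy (HN m ltac:(rewrite /m; lia)) qy (proj2 (Ha m)).
have H2 := HN' m ltac:(rewrite /m; lia).
have := Rabs_triang (F y - F (a m)) (F (a m) - l).
replace (F y - F (a m) + (F (a m) - l)) with (F y - l) by ring.
by move: H2; rewrite /Rdist; lra.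
Qed.

Lemma translate_neq0 n (p : pt n -> R) (c : pt n) :
  (exists x, p x <> 0) -> exists v, p (fun j => c j + v j) <> 0.
Proof.
move=> [x px]; exists (fun j => x j - c j).
by replace (fun j => _) with x by (apply: functional_extensionality => j; ring).
Qed.

Lemma rational_cont_at n (q F : pt n -> R) (x : pt n) :
  is_poly q -> rational_on q F -> q x <> 0 -> cont_at F x.
Proof.
move=> pq [P [Q [pP [pQ [Q0 FE]]]]] qx eps eps0.
have [d [d0 Hd]] := cont_at_neq0 _ _ _ (cont_at_poly _ _ x pq) qx.
have [d' [d'0 Hd']] := cont_at_div _ _ _ x (cont_at_poly _ _ x pP)
   (cont_at_poly _ _ x pQ) (Q0 x qx) eps eps0.
exists (Rmin d d'); split; first exact: Rmin_pos.
move=> y Hy; rewrite !FE //.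
  by apply: Hd'; apply: box_le Hy; apply: Rmin_r.
by apply: Hd; apply: box_le Hy; apply: Rmin_l.
Qed.

(* Translating the path from [a] to [b] by a small generic vector makes all its
   corners generic, so the mean value property applies to each edge. *)
Lemma generic_path_cauchy n (q F r : pt n -> R) (h : 'I_n -> pt n -> R) :
  is_poly q -> (exists x, q x <> 0) -> is_poly r -> (exists x, r x <> 0) ->
  (forall x, q x <> 0 -> cont_at F x) ->
  (forall j, continuous_on_Rn (h j)) ->
  (forall y, r y <> 0 -> forall j, mean_value_at q F (h j) j y) ->
  forall x eps, 0 < eps -> exists d, 0 < d /\ forall a b, box x d a -> box x d b ->
     q a <> 0 -> q b <> 0 -> Rabs (F a - F b) < eps.
Proof.
move=> pq q0 pr r0 cF ch mv x eps eps0.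
(* Bounding by [/ d] ties the bound to the radius: shrinking [d] weakens the claim, so a single
   common scale gives both a radius and a bound valid for all [h j]. *)
have [d0 [d0pos Hd0]] : exists d, 0 < d /\ forall j z, box x d z -> Rabs (h j z) <= / d.
  apply: (finite_common_scale 'I_n (fun j d => forall z, box x d z -> Rabs (h j z) <= / d)).
    move=> j d e dp de H z Hz.
    apply: (Rle_trans _ (/ e)); first by apply: H; apply: box_le Hz.
    exact: Rinv_le_contravar.
  move=> j; have [d [dp Hd]] := ch j x 1 Rlt_0_1.
  set K := Rabs (h j x) + 1.
  have K0 : 0 < K by rewrite /K; move: (Rabs_pos (h j x)); lra.
  have K'0 := Rinv_0_lt_compat _ K0.
  exists (Rmin d (/ K)); split; first exact: Rmin_pos.
  move=> z Hz; apply: (Rle_trans _ K).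
    have := Hd z (box_le _ _ _ _ _ (Rmin_l _ _) Hz).
    have := Rabs_triang (h j z - h j x) (h j x).
    by replace (h j z - h j x + h j x) with (h j z) by ring; rewrite /K; lra.
  rewrite -{1}(Rinv_inv K); apply: Rinv_le_contravar; first exact: Rmin_pos.
  exact: Rmin_r.
set M := / d0; have M0 : 0 < M by apply: Rinv_0_lt_compat.
have N0 := pos_INR n.
have c0 : 0 < 8 * (INR n + 1) * M by apply: Rmult_lt_0_compat; lra.
(* The translated endpoints lie within [2 * d <= d0] of [x], so the path contributes at most
   [4 * INR n * d * M <= eps / 2]; each endpoint translation costs [eps / 4]. The [+ 1] covers
   [n = 0]. *)
set d := Rmin (d0 / 2) (eps / (8 * (INR n + 1) * M)).
have dpos : 0 < d by apply: Rmin_pos; [lra|apply: Rdiv_lt_0_compat].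
have dd0 : d <= d0 / 2 by apply: Rmin_l.
have deps : 4 * INR n * (d * M) <= eps / 2.
  have H : d <= eps / (8 * (INR n + 1) * M) by apply: Rmin_r.
  have E : eps / (8 * (INR n + 1) * M) * (8 * (INR n + 1) * M) = eps by field; lra.
  have H1 := Rmult_le_compat_r _ _ _ (Rlt_le _ _ c0) H.
  have H2 : 0 < d * M by apply: Rmult_lt_0_compat.
  nra.
exists d; split => // a b Ha Hb qa qb.
have [ea [ea0 Hea]] := cF a qa (eps / 4) ltac:(lra).
have [eb [eb0 Heb]] := cF b qb (eps / 4) ltac:(lra).
(* A translation vector [v] is good for the [m]-th corner when [s m v <> 0]; there are [n.+1]
   corners, endpoints included. *)
pose s m v := q (fun j => corner a b m j + v j) * r (fun j => corner a b m j + v j).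
have ps m : is_poly (s m) by apply: poly_mul; apply: poly_translate.
have s0 m : exists v, s m v <> 0.
  by apply: poly_mul_neq0; try (exact: poly_translate); apply: translate_neq0.
set e := Rmin d (Rmin ea eb).
have e0 : 0 < e by apply: Rmin_pos => //; apply: Rmin_pos.
have [v [Hv sv]] := poly_family_generic _ s n.+1 ps s0 e e0.
pose tr (c : pt n) : pt n := fun j => c j + v j.
have tr_box c e' : e <= e' -> box c e' (tr c).
  move=> ee i; rewrite /tr; replace (c i + v i - c i) with (v i - 0) by ring.
  exact: Rlt_le_trans (Hv i) ee.
have cornerE m : corner (tr a) (tr b) m = tr (corner a b m).
  by apply: functional_extensionality => j; rewrite /corner /tr; case: ifP.
have ed : e <= d by apply: Rmin_l.
have eab : e <= Rmin ea eb by apply: Rmin_r.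
have eae : e <= ea := Rle_trans _ _ _ eab (Rmin_l _ _).
have ebe : e <= eb := Rle_trans _ _ _ eab (Rmin_r _ _).
have Ha' := box_trans _ _ _ _ _ _ Ha (tr_box a d ed).
have Hb' := box_trans _ _ _ _ _ _ Hb (tr_box b d ed).
have Hpath : Rabs (F (tr b) - F (tr a)) <= INR n * (2 * (d + d) * M).
  apply: (path_bound _ q F h x) => //; first lra.
  - by move=> j z Hz; apply: Hd0; apply: box_le Hz; lra.
  - by move=> m mn; rewrite cornerE => E; apply: (sv m) => //; rewrite /s E; ring.
  - by move=> m mn; rewrite cornerE; apply: mv => E; apply: (sv m) => //; rewrite /s E; ring.
have H1 := Hea _ (tr_box a ea eae); have H2 := Heb _ (tr_box b eb ebe).
move: (Rabs_def2 _ _ H1) (Rabs_def2 _ _ H2) => ? ?.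
have ? : - (eps / 2) <= F (tr b) - F (tr a) <= eps / 2.
  have := Rle_abs (F (tr b) - F (tr a)); have := Rle_abs (- (F (tr b) - F (tr a))).
  rewrite Rabs_Ropp; lra.
apply: Rabs_def1; lra.
Qed.

(** The extension [g] sends [x] to the limit of [F] through points of [q <> 0]. Its partial
    derivatives are found by passing to the limit in the mean value identity on nearby generic
    lines. *)
Lemma extend_step n (q F : pt n -> R) (h : 'I_n -> pt n -> R) :
  is_poly q -> (exists x, q x <> 0) -> rational_on q F ->
  (forall j x, q x <> 0 -> partial_at F j x (h j x)) ->
  (forall j, continuous_on_Rn (h j)) ->
  exists g, continuous_on_Rn g /\ (forall x, q x <> 0 -> g x = F x) /\
    forall j x, partial_at g j x (h j x).
Proof.
move=> pq q0 ratF dF ch.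
have [r [pr [r0 mv]]] := finite_generic n 'I_n (fun j => mean_value_at q F (h j) j)
  (fun j => generic_mean_value _ _ _ _ j pq q0 ratF (dF j) (ch j)).
have cF x := rational_cont_at n q F x pq ratF.
have cau := generic_path_cauchy _ q F r h pq q0 pr r0 cF ch mv.
have [g Hg] := functional_choice _ (fun x => cauchy_limit _ q F x pq q0 (cau x)).
exists g; split; [|split].
- move=> x eps eps0; have [d [d0 Hd]] := Hg x (eps / 2) ltac:(lra).
  exists (d / 2); split; first lra.
  move=> y Hy; have [d' [d'0 Hd']] := Hg y (eps / 2) ltac:(lra).
  have m0 : 0 < Rmin (d / 2) d' by apply: Rmin_pos; lra.
  have [z [Hz qz]] := poly_neq0_dense _ _ pq q0 y _ m0.
  have H1 := Hd' z (box_le _ _ _ _ _ (Rmin_r _ _) Hz) qz.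
  have H2 : Rabs (F z - g x) < eps / 2.
    apply: Hd => //; apply: (box_le _ _ _ (d / 2 + d / 2)); first lra.
    exact: box_trans Hy (box_le _ _ _ _ _ (Rmin_l _ _) Hz).
  move: (Rabs_def2 _ _ H1) (Rabs_def2 _ _ H2) => ? ?; apply: Rabs_def1; lra.
- move=> x qx; apply: cond_eq => eps eps0; rewrite Rabs_minus_sym.
  by have [d [d0 Hd]] := Hg x eps eps0; apply: Hd => //; apply: box_refl.
- move=> j x eps eps0.
  have [d [d0 Hd]] := ch j x (eps / 2) ltac:(lra).
  have d20 : 0 < d / 2 by lra.
  (* Half of [d] is reserved for the distance from [x] to a generic [y], the other half for the
     displacement along the edge. *)
  exists (mkposreal _ d20) => t t0 /= td; rewrite Rplus_0_l shift0.
  have tpos := Rabs_pos_lt _ t0.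
  suff H : Rabs (g (shift x j t) - g x - t * h j x) <= Rabs t * (eps / 2).
    have -> : (g (shift x j t) - g x) / t - h j x =
        (g (shift x j t) - g x - t * h j x) * / t by field.
    rewrite Rabs_mult Rabs_inv.
    have H1 := Rmult_le_compat_r _ _ _ (Rlt_le _ _ (Rinv_0_lt_compat _ tpos)) H.
    have E : Rabs t * (eps / 2) * / Rabs t = eps / 2 by field; lra.
    lra.
  (* The slack [eta] pays for replacing [g] at both ends of the edge by values of [F] at generic
     points, [eta / 2] each. *)
  apply: Rle_plus_epsilon => eta eta0.
  have [d1 [d10 Hd1]] := Hg x (eta / 2) ltac:(lra).
  have [d2 [d20' Hd2]] := Hg (shift x j t) (eta / 2) ltac:(lra).
  set e := Rmin (d / 2) (Rmin d1 d2).
  have e0 : 0 < e by apply: Rmin_pos => //; apply: Rmin_pos.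
  have ed : e <= d / 2 by apply: Rmin_l.
  have e12 : e <= Rmin d1 d2 by apply: Rmin_r.
  have ed1 : e <= d1 := Rle_trans _ _ _ e12 (Rmin_l _ _).
  have ed2 : e <= d2 := Rle_trans _ _ _ e12 (Rmin_r _ _).
  (* Writing the shift as a translation shows that [q (shift y j t)] is a polynomial in [y], so one
     [y] can avoid its zeros together with those of [q] and [r]. *)
  pose tvec : pt n := shift (fun _ => 0) j t.
  have tvE y : (fun i => tvec i + y i) = shift y j t.
    apply: functional_extensionality => i; rewrite /tvec /shift; case: eqP => _; ring.
  have pqt := poly_translate _ _ tvec pq.
  have [|y [Hy Ny]] := poly_neq0_dense _ _
    (poly_mul (poly_mul pq pr) pqt) _ x e e0.
    apply: poly_mul_neq0 => //; first exact: poly_mul.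
      exact: poly_mul_neq0.
    exact: translate_neq0.
  have qy : q y <> 0 by move=> E; apply: Ny; rewrite E; ring.
  have ry : r y <> 0 by move=> E; apply: Ny; rewrite E; ring.
  have qty : q (shift y j t) <> 0 by rewrite -tvE => E; apply: Ny; rewrite E; ring.
  have [c [Hc Ec]] := mv y ry j t qy qty.
  have Hy1 := Hd1 y (box_le _ _ _ _ _ ed1 Hy) qy.
  have Hy2 := Hd2 _ (box_shift _ _ _ j t _ (box_le _ _ _ _ _ ed2 Hy)) qty.
  have bc : box x d (shift y j c).
    apply: (box_le _ _ _ (d / 2 + d / 2)); first lra.
    apply: box_trans (box_le _ _ _ _ _ ed Hy) _.
    rewrite -{1}(shift0 _ y j); apply: box_shift_self; rewrite Rminus_0_r.
    move: (Rabs_def2 _ _ td) => ?; apply: Rabs_def1; lra.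
  have Hh := Hd _ bc.
  have Hth : Rabs (t * (h j (shift y j c) - h j x)) <= Rabs t * (eps / 2).
    rewrite Rabs_mult; apply: Rmult_le_compat_l; lra.
  have -> : g (shift x j t) - g x - t * h j x =
     t * (h j (shift y j c) - h j x) +
     ((F y - g x) - (F (shift y j t) - g (shift x j t))).
    rewrite Rmult_minus_distr_l -Ec; ring.
  have := Rabs_triang (t * (h j (shift y j c) - h j x))
     ((F y - g x) - (F (shift y j t) - g (shift x j t))).
  have := Rabs_triang (F y - g x) (- (F (shift y j t) - g (shift x j t))).
  rewrite Rabs_Ropp -/(Rminus (F y - g x) (F (shift y j t) - g (shift x j t))); lra.
Qed.

(** * Induction on the order of differentiation, and the equivalence *)

Lemma partials_on_ext n (q F G D : pt n -> R) (U : pt n -> Prop) (ids : seq 'I_n) :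
  is_poly q -> (forall x, q x <> 0 -> U x) -> (forall x, q x <> 0 -> F x = G x) ->
  partials_on U F ids D -> partials_on (fun x => q x <> 0) G ids D.
Proof.
move=> pq qU; elim: ids F G => [|i ids IH] F G FG /=.
  by move=> H x qx; rewrite H ?FG //; apply: qU.
move=> [F' [HF' H]]; exists F'; split; last exact: (IH F').
move=> x qx; have [d [d0 Hd]] := cont_at_neq0 _ _ _ (cont_at_poly _ _ x pq) qx.
apply: (partial_ext _ F G i x d) => //; last by apply: HF'; apply: qU.
by move=> y /Hd; apply: FG.
Qed.

(** Each first partial of [F] is again rational on [q <> 0], and its partials of order [k] are
    partials of [F] of order [k.+1]. By induction it extends to a [Ck k] function, and one extension
    step then yields [g] with exactly these functions as first partials. *)
Lemma extend_Ck n (q : pt n -> R) (k : nat) (F : pt n -> R) :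
  is_poly q -> (exists x, q x <> 0) -> rational_on q F ->
  (forall ids : seq 'I_n, size ids = k -> exists D h,
     partials_on (fun x => q x <> 0) F ids D /\ continuous_on_Rn h /\
     forall x, q x <> 0 -> h x = D x) ->
  exists g, Ck k g /\ forall x, q x <> 0 -> g x = F x.
Proof.
move=> pq q0; elim: k F => [|k IH] F ratF H.
  have [D [h [DF [ch hD]]]] := H [::] erefl.
  by exists h; split => // x qx; rewrite hD // DF.
have Hh i : exists h, Ck k h /\ forall x, q x <> 0 -> partial_at F i x (h x).
  have [G [ratG dG]] := rational_partial _ _ _ i pq ratF.
  have [|g [Cg gG]] := IH G ratG.
    (* The hypothesis provides its own first partial [G'], which agrees with [G] on [q <> 0] by
       uniqueness of derivatives. *)
    move=> ids sz; have [|D [h [[G' [dG' HD]] [ch hD]]]] := H (i :: ids).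
      by rewrite /= sz.
    exists D, h; split => //; apply: partials_on_ext HD => // x qx.
    exact: uniqueness_limite (dG' x qx) (dG x qx).
  by exists g; split => // x qx; rewrite gG //; apply: dG.
have [h Hh'] := functional_choice _ Hh.
have Ck_cont (u : pt n -> R) : Ck k u -> continuous_on_Rn u.
  by case: (k) => [//|m []].
have [||g [cg [gF dg]]] := extend_step _ q F h pq q0 ratF.
- by move=> j; apply: (proj2 (Hh' j)).
- by move=> j; apply: Ck_cont; apply: (proj1 (Hh' j)).
exists g; split => //; split => // i; exists (h i); split => //.
exact: (proj1 (Hh' i)).
Qed.

Lemma Ck_partials n (U : pt n -> Prop) (ids : seq 'I_n) (g : pt n -> R) :
  Ck (size ids) g -> exists D, partials_on U g ids D /\ continuous_on_Rn D.
Proof.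
elim: ids g => [|i ids IH] g /=; first by exists g.
move=> [_ /(_ i) [G [dG CG]]]; have [D [HD cD]] := IH G CG.
by exists D; split => //; exists G.
Qed.

Theorem theorem2p12 (n k : nat) (p q : pt n -> R) :
  (0 < k)%nat ->
  is_poly p -> is_poly q -> (exists x, q x <> 0) ->
  codim_ge2 (rat_pol p q) ->
  ((exists g, regulous k g /\ agrees_on (rat_dom p q) g p q) <->
   (forall ids : seq 'I_n, size ids = k ->
      exists F D h, agrees_on (rat_dom p q) F p q /\
        partials_on (rat_dom p q) F ids D /\
        continuous_on_Rn h /\ (forall x, rat_dom p q x -> h x = D x))).
Proof.
move=> _ pp pq q0 _; split.
  (* The partials of [g] are defined and continuous on all of the space, so [g] serves as [F] and
     its iterated partial as both [D] and [h]. *)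
  move=> [g [[Cg _] ag]] ids sz; rewrite -sz in Cg.
  have [D [HD cD]] := Ck_partials _ (rat_dom p q) _ _ Cg.
  by exists g, D, D.
move=> H.
have qdom x : q x <> 0 -> rat_dom p q x.
  by move=> qx; exists p, q.
have ratF : rational_on q (fun x => p x / q x) by exists p, q.
have [|g [Cg gF]] := extend_Ck _ q k _ pq q0 ratF.
  (* The function [F] may vary with [ids], but always equals [p / q] on the open set [q <> 0]. *)
  move=> ids sz; have [F [D [h [aF [HD [ch hD]]]]]] := H ids sz.
  exists D, h; split; last by split => // x /qdom /hD.
  apply: (partials_on_ext _ q F _ _ (rat_dom p q)) => // x qx.
  exact: aF (qdom x qx) pp pq qx (fun y => erefl).
have cg : continuous_on_Rn g by move: Cg; case: (k) => [//|m []].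
exists g; split.
  split => //; exists p, q, (fun x => q x <> 0); split => //; split => //; split => //.
  (* The complement of [q <> 0] is cut out by the single equation [q = 0]. *)
  exists (fun s => s = q); split; first by move=> s ->.
  move=> x; split; first by move=> /NNPP qx s ->.
  by move=> /(_ q erefl) qx.
(* At points of the domain where [q] may vanish, clear the denominator: [g * q'] and [p'] are
   continuous and agree on the dense set [q <> 0], hence at [x]. *)
move=> x p' q' _ pp' pq' q'x E.
have : g x * q' x = p' x; last by move=> <-; field.
apply: (eq_of_dense _ q (fun y => g y * q' y) p') => //.
- by apply: cont_at_mul; [apply: cg|apply: cont_at_poly].
- exact: cont_at_poly.
- move=> y qy; rewrite gF //.
  by apply: (Rmult_eq_reg_r (q y)) => //; rewrite E; field.
Qed.
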